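(* The functions $t:\mathfrak F_D\to\mathfrak F_\Box$ and $s:\mathfrak F_\Box\to\mathfrak F_D$ are translations, that is: (i) $\Gamma\vdash_D\alpha$ if and only if $\Gamma^t\vdash_\Box\alpha^t$, for all $\Gamma\cup\{\alpha\}\subseteq\mathfrak F_D$; (ii) $\Gamma\vdash_\Box\alpha$ if and only if $\Gamma^s\vdash_D\alpha^s$, for all $\Gamma\cup\{\alpha\}\subseteq\mathfrak F_\Box$. Furthermore, via these translations the logics $\mathbf{ID}_3$ and $\mathbf{I\Box}_3$ are equivalent.
   Context: **Languages.** Fix a denumerable set of individual variables and a non-empty set of relation letters, each of some arity $n\ge1$ (no function symbols, constants or equality). $\mathfrak F_D$ is the set of first-order formulas built with connectives $\land,\lor,\neg,D,\bot$ (arities $2,2,1,1,0$) and quantifiers $\forall,\exists$; $\mathfrak F_\Box$ is the set of first-order formulas built in the same way with the unary connective $\Box$ in place of $D$. **Common rules.** Both logics are natural deduction systems containing the usual Gentzen introduction/elimination rules for $\land$ and $\lor$; the rules for intuitionistic negation: ($\neg$I) from a derivation of $\bot$ from assumption $\alpha$ infer $\neg\alpha$, discharging $\alpha$; ($\neg$E) from $\alpha$ and $\neg\alpha$ infer $\bot$; (EASQ) from $\bot$ infer $\alpha$; and the usual Gentzen introduction/elimination rules for $\forall,\exists$ with the usual eigenvariable conditions. **$\mathbf{ID}_3$** (formulas $\mathfrak F_D$, derivability $\vdash_D$) has in addition: ($D$I) infer $\alpha\lor D\alpha$ from no premises; ($D$E) from $D\alpha$ together with a derivation of $\alpha\lor\beta$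 having no undischarged assumptions, infer $\beta$; (S) infer $\neg\alpha\lor\neg\neg\alpha$ from no premises; (cS) from $D\alpha$ and $DD\alpha$ infer $\bot$; (Reg) from $\alpha$ and $D\alpha$ infer $\beta\lor\neg\beta$. **$\mathbf{I\Box}_3$** (formulas $\mathfrak F_\Box$, derivability $\vdash_\Box$) has in addition to the common rules: ($\neg\Box$I) infer $\alpha\lor\neg\Box\alpha$ from no premises; ($\neg\Box$E) from $\neg\Box\alpha$ together with a derivation of $\alpha\lor\beta$ having no undischarged assumptions, infer $\beta$; ($\Box$S) from $\neg\alpha$ infer $\Box\neg\alpha$; ($\Box$cS) from $\neg\Box\neg\Box\alpha$ infer $\Box\alpha$; ($\Box$Reg) from $\alpha$ and $\neg\Box\alpha$ infer $\beta\lor\neg\beta$. In each logic $\Gamma\vdash\alpha$ means there is a derivation of $\alpha$ whose undischarged assumptions all lie in $\Gamma$; $\alpha\dashv\vdash\beta$ means $\alpha\vdash\beta$ and $\beta\vdash\alpha$. **Functions.** $\alpha^t$ is obtained from $\alpha\in\mathfrak F_D$ by uniformly (recursively) replacing every occurrence of $D$ by $\neg\Box$; $\beta^s$ is obtained from $\beta\in\mathfrak F_\Box$ by replacing every occurrence of $\Box$ by $\neg D$. $\Gamma^t=\{\gamma^t:\gamma\in\Gamma\}$, $\Gamma^s=\{\gamma^s:\gamma\in\Gamma\}$. **Equivalence of the logics** via $t$ and $s$ means that (i) and (ii) hold and that $t,s$ are mutually inverse up to interderivability: $\alpha\dashv\vdash_D(\alpha^t)^s$ for all $\alpha\in\mathfrak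 F_D$ and $\beta\dashv\vdash_\Box(\beta^s)^t$ for all $\beta\in\mathfrak F_\Box$. *)

(* Defs.v *)
From mathcomp Require Import all_boot.
From mathcomp Require Import boolp classical_sets.

Set Implicit Arguments.
Unset Strict Implicit.
Unset Printing Implicit Defensive.

Local Open Scope classical_set_scope.

Record signature := Signature {
  letter : Type;
  arity : letter -> nat;
  arity_gt0 : forall r, (0 < arity r)%N;
  letter_inhabited : inhabited letter
}.

Definition var := nat.

Variant lang := LD | LBox.

(* The two languages differ only in the name of the unary operator [Mod]: it is
   D in [form sig LD] and Box in [form sig LBox].  Terms are variables. *)
Inductive form (sig : signature) (L : lang) : Type :=
| Atom (r : letter sig) of (arity r).-tuple var
| And of form sig L & form sig L
| Or of form sig L & form sig L
| Neg of form sig L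
| Mod of form sig L
| Bot
| All of var & form sig L
| Ex of var & form sig L.

Arguments Atom {sig L}.
Arguments And {sig L}.
Arguments Or {sig L}.
Arguments Neg {sig L}.
Arguments Mod {sig L}.
Arguments Bot {sig L}.
Arguments All {sig L}.
Arguments Ex {sig L}.

Notation Dop := (@Mod _ LD).
Notation Box := (@Mod _ LBox).

Fixpoint free (sig : signature) (L : lang) (x : var) (a : form sig L) : bool :=
  match a with
  | Atom r v => x \in v
  | And b c | Or b c => free x b || free x c
  | Neg b | Mod b => free x b
  | Bot => false
  | All z b | Ex z b => (x != z) && free x b
  end.

(* [subst x y a] replaces the free occurrences of x by y, without renaming of
   bound variables; [free_for y x a] says that no y so introduced is captured. *)
Fixpoint subst (sig : signature) (L : lang) (x y : var) (a : form sig L)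
    : form sig L :=
  match a with
  | Atom r v => Atom r (map_tuple (fun z => if z == x then y else z) v)
  | And b c => And (subst x y b) (subst x y c)
  | Or b c => Or (subst x y b) (subst x y c)
  | Neg b => Neg (subst x y b)
  | Mod b => Mod (subst x y b)
  | Bot => Bot
  | All z b => All z (if z == x then b else subst x y b)
  | Ex z b => Ex z (if z == x then b else subst x y b)
  end.

Fixpoint free_for (sig : signature) (L : lang) (y x : var) (a : form sig L)
    : bool :=
  match a with
  | Atom _ _ | Bot => true
  | And b c | Or b c => free_for y x b && free_for y x c
  | Neg b | Mod b => free_for y x b
  | All z b | Ex z b =>
      [|| z == x, ~~ free x b | (z != y) && free_for y x b]
  end.

(* A set of rules: [R P Q c] means that c may be inferred from derivations of
   the formulas in P together with derivations, having no undischarged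
   assumptions, of the formulas in Q. *)
Definition rules (sig : signature) (L : lang) :=
  set (form sig L) -> set (form sig L) -> form sig L -> Prop.

(* [der R A a]: there is a derivation of a, by the common rules and the rules in
   R, whose set of undischarged assumptions is exactly A.  A discharging rule
   discharges all the occurrences (possibly none) of the formula concerned.
   In [der_allI] and [der_exE], y is the eigenvariable; it may be x itself. *)
Inductive der (sig : signature) (L : lang) (R : rules sig L)
    : set (form sig L) -> form sig L -> Prop :=
| der_assume a : der R [set a] a
| der_andI A B a b : der R A a -> der R B b -> der R (A `|` B) (And a b)
| der_andE1 A a b : der R A (And a b) -> der R A a
| der_andE2 A a b : der R A (And a b) -> der R A b
| der_orI1 A a b : der R A a -> der R A (Or a b)
| der_orI2 A a b : der R A b -> der R A (Or a b)
| der_orE A B C a b c : der R A (Or a b) -> der R B c -> der R C c ->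
    der R (A `|` (B `\ a) `|` (C `\ b)) c
| der_negI A a : der R A Bot -> der R (A `\ a) (Neg a)
| der_negE A B a : der R A a -> der R B (Neg a) -> der R (A `|` B) Bot
| der_efq A a : der R A Bot -> der R A a
| der_allI A x y a : der R A (subst x y a) -> free_for y x a ->
    ~~ free y (All x a) -> (forall g, A g -> ~~ free y g) ->
    der R A (All x a)
| der_allE A x y a : der R A (All x a) -> free_for y x a ->
    der R A (subst x y a)
| der_exI A x y a : der R A (subst x y a) -> free_for y x a ->
    der R A (Ex x a)
| der_exE A B x y a c : der R A (Ex x a) -> der R B c -> free_for y x a ->
    ~~ free y (Ex x a) -> ~~ free y c ->
    (forall g, (B `\ subst x y a) g -> ~~ free y g) ->
    der R (A `|` (B `\ subst x y a)) c
| der_rule P Q c (A : form sig L -> set (form sig L)) : R P Q c ->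
    (forall p, P p -> der R (A p) p) -> (forall q, Q q -> der R set0 q) ->
    der R (\bigcup_(p in P) A p) c.

Inductive rules_ID3 (sig : signature) : rules sig LD :=
| D_I a : rules_ID3 set0 set0 (Or a (Dop a))
| D_E a b : rules_ID3 [set Dop a] [set Or a b] b
| D_S a : rules_ID3 set0 set0 (Or (Neg a) (Neg (Neg a)))
| D_cS a : rules_ID3 [set Dop a; Dop (Dop a)] set0 Bot
| D_Reg a b : rules_ID3 [set a; Dop a] set0 (Or b (Neg b)).

Inductive rules_IBox3 (sig : signature) : rules sig LBox :=
| NBox_I a : rules_IBox3 set0 set0 (Or a (Neg (Box a)))
| NBox_E a b : rules_IBox3 [set Neg (Box a)] [set Or a b] b
| Box_S a : rules_IBox3 [set Neg a] set0 (Box (Neg a))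
| Box_cS a : rules_IBox3 [set Neg (Box (Neg (Box a)))] set0 (Box a)
| Box_Reg a b : rules_IBox3 [set a; Neg (Box a)] set0 (Or b (Neg b)).

Definition entails (sig : signature) (L : lang) (R : rules sig L)
    (G : set (form sig L)) (a : form sig L) : Prop :=
  exists2 A, A `<=` G & der R A a.

Definition entails_D (sig : signature) := entails (@rules_ID3 sig).
Definition entails_Box (sig : signature) := entails (@rules_IBox3 sig).

Fixpoint t (sig : signature) (a : form sig LD) : form sig LBox :=
  match a with
  | Atom r v => Atom r v
  | And b c => And (t b) (t c)
  | Or b c => Or (t b) (t c)
  | Neg b => Neg (t b)
  | Mod b => Neg (Box (t b))
  | Bot => Bot
  | All x b => All x (t b)
  | Ex x b => Ex x (t b)
  end.

Fixpoint s (sig : signature) (a : form sig LBox) : form sig LD :=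
  match a with
  | Atom r v => Atom r v
  | And b c => And (s b) (s c)
  | Or b c => Or (s b) (s c)
  | Neg b => Neg (s b)
  | Mod b => Neg (Dop (s b))
  | Bot => Bot
  | All x b => All x (s b)
  | Ex x b => Ex x (s b)
  end.

Definition translation (F1 F2 : Type) (E1 : set F1 -> F1 -> Prop)
    (E2 : set F2 -> F2 -> Prop) (f : F1 -> F2) : Prop :=
  forall (G : set F1) (a : F1), E1 G a <-> E2 (f @` G) (f a).

Definition interderivable (F : Type) (E : set F -> F -> Prop) (a b : F) : Prop :=
  E [set a] b /\ E [set b] a.

Definition equivalent_via (F1 F2 : Type) (E1 : set F1 -> F1 -> Prop)
    (E2 : set F2 -> F2 -> Prop) (f : F1 -> F2) (g : F2 -> F1) : Prop :=
  [/\ translation E1 E2 f, translation E2 E1 g,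
      forall a, interderivable E1 a (g (f a)) &
      forall b, interderivable E2 b (f (g b))].

(* Main.v *)
Require Import Defs.
From mathcomp Require Import all_boot.
From mathcomp Require Import boolp classical_sets cardinality.

Local Open Scope classical_set_scope.

(** Both translations are the same map, [translate]: it renames the unary
    operator and puts a negation in front of it.  It commutes with
    substitution and keeps free variables, so it carries every instance of a
    common rule to an instance of the same rule, eigenvariable conditions
    included ([entails_translate]).  Soundness of t and s is thus a matter of
    deriving the translations of the special rules.

    For t, only (S) and (cS) are not again rules: from NBox_I for the
    formula Neg a one gets (S), since Box_S turns Neg a into Box (Neg a), and
    the translation of (cS) is Box_cS followed by a contradiction.  For s,
    everything rests on [dneg_D]: a formula D a is stable, that is,
    Neg (Neg (D a)) entails D a.  The reason is that D_I gives D a or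
    D (D a), that the latter refutes D a by (cS), and that in the former case
    there is nothing to do.  Box_S and Box_cS then come from an instance of
    (S), one disjunct of which is struck off by D_E.

    Faithfulness follows from soundness of the map in the other direction
    once each formula a is interderivable with its double translation: if the
    translation of a follows from that of G, translating again and cutting
    with these interderivabilities gives a from G.  Cutting needs a finite set
    of assumptions, because it is done one formula at a time, by applying
    disjunction elimination to Or a a: the language has no implication.

    Interderivability with the double translation is an induction on the
    formula ([double_translate]).  At the unary operator it asks that the
    operator respect interderivability and be stable under double negation.
    The rules D_E and NBox_E make D and Neg Box antitone with respect to
    entailment: if b entails a, then a or D b is a theorem, so that D a entails
    D b.  For Box, antitonicity of Neg Box is enough because Box is stable as
    well, by Box_cS and NBox_I for the formula Neg (Box a). *)

(** * Rules for entailment from a fixed set of assumptions *)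

Section Rules.
Set Implicit Arguments.
Unset Strict Implicit.
Context (sig : signature) (L : lang) (R : rules sig L).
Implicit Types (G H : set (form sig L)) (a b c : form sig L).

Lemma entails_sub G H a : H `<=` G -> entails R H a -> entails R G a.
Proof. by move=> HG [A AH d]; exists A => //; apply: subset_trans HG. Qed.

Lemma entails_assume G a : G a -> entails R G a.
Proof. by move=> Ga; exists [set a]; [move=> _ -> | apply: der_assume]. Qed.

Lemma entails_andI G a b :
  entails R G a -> entails R G b -> entails R G (And a b).
Proof.
move=> [A AG da] [B BG db]; exists (A `|` B); last exact: der_andI.
by rewrite subUset.
Qed.

Lemma entails_andE1 G a b : entails R G (And a b) -> entails R G a.
Proof. by move=> [A AG d]; exists A => //; apply: der_andE1 d. Qed.

Lemma entails_andE2 G a b : entails R G (And a b) -> entails R G b.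
Proof. by move=> [A AG d]; exists A => //; apply: der_andE2 d. Qed.

Lemma entails_orI1 G a b : entails R G a -> entails R G (Or a b).
Proof. by move=> [A AG d]; exists A => //; apply: der_orI1. Qed.

Lemma entails_orI2 G a b : entails R G b -> entails R G (Or a b).
Proof. by move=> [A AG d]; exists A => //; apply: der_orI2. Qed.

Lemma discharge_sub G a (A : set (form sig L)) :
  A `<=` a |` G -> A `\ a `<=` G.
Proof. by move=> AG g [/AG[]]. Qed.

Lemma entails_orE G a b c : entails R G (Or a b) ->
  entails R (a |` G) c -> entails R (b |` G) c -> entails R G c.
Proof.
move=> [A AG dab] [B /discharge_sub BG da] [C /discharge_sub CG db].
exists (A `|` (B `\ a) `|` (C `\ b)); last exact: der_orE.
by rewrite !subUset.
Qed.

Lemma entails_negI G a : entails R (a |` G) Bot -> entails R G (Neg a).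
Proof.
by move=> [A /discharge_sub AG d]; exists (A `\ a) => //; apply: der_negI.
Qed.

Lemma entails_negE G a :
  entails R G a -> entails R G (Neg a) -> entails R G Bot.
Proof.
move=> [A AG da] [B BG db]; exists (A `|` B); last exact: der_negE da db.
by rewrite subUset.
Qed.

Lemma entails_efq G a : entails R G Bot -> entails R G a.
Proof. by move=> [A AG d]; exists A => //; apply: der_efq. Qed.

Lemma entails_allI G x y a : entails R G (subst x y a) -> free_for y x a ->
  ~~ free y (All x a) -> (forall g, G g -> ~~ free y g) ->
  entails R G (All x a).
Proof.
move=> [A AG d] ff fr frG; exists A => //; apply: (der_allI d) => // g /AG.
exact: frG.
Qed.

Lemma entails_allE G x y a :
  entails R G (All x a) -> free_for y x a -> entails R G (subst x y a).
Proof. by move=> [A AG d] ff; exists A => //; apply: der_allE. Qed.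

Lemma entails_exI G x y a :
  entails R G (subst x y a) -> free_for y x a -> entails R G (Ex x a).
Proof. by move=> [A AG d] ff; exists A => //; apply: der_exI ff. Qed.

(** The eigenvariable condition bears on the assumptions [H] of the minor
    premise alone, hence two sets of assumptions. *)
Lemma entails_exE G H x y a c : entails R G (Ex x a) ->
  entails R (subst x y a |` H) c -> free_for y x a -> ~~ free y (Ex x a) ->
  ~~ free y c -> (forall h, H h -> ~~ free y h) -> entails R (G `|` H) c.
Proof.
move=> [A AG da] [B /discharge_sub BH db] ff fr frc frH.
exists (A `|` (B `\ subst x y a)); first exact: setUSS.
by apply: (der_exE da) => // h /BH; apply: frH.
Qed.

Lemma entails_rule P Q c G : R P Q c ->
  (forall p, P p -> entails R G p) -> (forall q, Q q -> entails R set0 q) ->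
  entails R G c.
Proof.
move=> Rc dP dQ.
have /choice[A dA] : forall p, exists A, P p -> A `<=` G /\ der R A p.
  move=> p; have [/dP[A AG d]|nPp] := pselect (P p); first by exists A.
  by exists set0.
exists (\bigcup_(p in P) A p); first by apply: bigcup_sub => p /dA[].
apply: (der_rule Rc) => [p /dA[]//|q /dQ[B]].
by rewrite subset0 => ->.
Qed.

Lemma entails_axiom c G : R set0 set0 c -> entails R G c.
Proof. by move=> Rc; apply: (entails_rule Rc). Qed.

(** Disjunction elimination from Or a a stands in for the missing
    implication. *)
Lemma entails_cut G a b :
  entails R G a -> entails R (a |` G) b -> entails R G b.
Proof. by move=> da db; apply: (entails_orE (entails_orI1 a da)). Qed.

Lemma entails_cut1 G a b :
  entails R G a -> entails R [set a] b -> entails R G b.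
Proof.
move=> da db; apply: entails_cut da _; apply: entails_sub db.
by move=> _ ->; left.
Qed.

Lemma neg_antitone G a b :
  entails R [set a] b -> entails R G (Neg b) -> entails R G (Neg a).
Proof.
move=> dab dnb; apply: entails_negI; apply: (entails_negE (a := b)).
  by apply: entails_cut1 dab; apply: entails_assume; left.
by apply: entails_sub dnb; apply: subsetUr.
Qed.

Lemma dneg_intro a : entails R [set a] (Neg (Neg a)).
Proof.
apply: entails_negI; apply: (entails_negE (a := a)); apply: entails_assume.
  by right.
by left.
Qed.

(** * Finiteness of derivations and multiple cuts *)

Definition finitary := forall P Q c, R P Q c -> finite_set P.

Lemma der_finite A a : finitary -> der R A a -> finite_set A.
Proof.
move=> finR; elim=> // {A a}.
- by move=> A B a b _ fA _ fB; rewrite finite_setU.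
- move=> A B C a b c _ fA _ fB _ fC; rewrite !finite_setU.
  by do !split=> //; apply: finite_setD.
- by move=> A a _ fA; apply: finite_setD.
- by move=> A B a _ fA _ fB; rewrite finite_setU.
- move=> A B x y a c _ fA _ fB _ _ _ _; rewrite finite_setU.
  by split=> //; apply: finite_setD.
- by move=> P Q c A /finR fP _ fA _ _; apply: bigcup_finite.
Qed.

Lemma entails_cuts G H a : finitary -> entails R G a ->
  (forall g, G g -> entails R H g) -> entails R H a.
Proof.
move=> finR [A AG d] dG; have [n An] := der_finite finR d.
have {G AG dG} : forall g, A g -> entails R H g by move=> g /AG/dG.
have {d} : entails R (A `|` H) a by exists A => //; apply: subsetUl.
elim: n => [|n IHn] in A An *.
  by move: An; rewrite II0 card_eq0 => /eqP ->; rewrite set0U.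
have /eq_cardSP[b Ab bAn] := An; move=> da dA.
apply: IHn bAn _ _ => [|g [/dA]//].
apply: (entails_cut (a := b)).
  by apply: entails_sub (dA _ Ab); apply: subsetUr.
by apply: entails_sub da; rewrite setUA setDUK // => _ ->.
Qed.

(** * Interderivability *)

Notation "a -||- b" := (interderivable (entails R) a b)
  (at level 70, no associativity).

Lemma interderivable_refl a : a -||- a.
Proof. by split; apply: entails_assume. Qed.

Lemma and_mono a a' b b' : entails R [set a] a' -> entails R [set b] b' ->
  entails R [set And a b] (And a' b').
Proof.
move=> da db; have h := entails_assume (G := [set And a b]) erefl.
apply: entails_andI; [apply: entails_cut1 da|apply: entails_cut1 db].
  exact: entails_andE1 h.
exact: entails_andE2 h.
Qed.

Lemma or_mono G a a' b b' :
  entails R [set a] a' -> entails R [set b] b' ->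
  entails R G (Or a b) -> entails R G (Or a' b').
Proof.
move=> da db h; apply: (entails_orE h).
  by apply: entails_orI1; apply: entails_sub da => _ ->; left.
by apply: entails_orI2; apply: entails_sub db => _ ->; left.
Qed.

Lemma subst_id x a : subst x x a = a.
Proof.
elim: a => //= [r v|a -> b ->|a -> b ->|a ->|a ->|z a ->|z a ->] //.
- congr Atom; apply: eq_from_tnth => i; rewrite tnth_map.
  by case: eqP.
- by rewrite if_same.
- by rewrite if_same.
Qed.

Lemma free_for_id x a : free_for x x a.
Proof.
elim: a => //= [a -> b ->|a -> b ->|z a ->|z a ->] //.
  by case: eqP => //; rewrite orbT.
by case: eqP => //; rewrite orbT.
Qed.

(** The bound variable itself serves as eigenvariable, as it is not free in
    the only assumption. *)
Lemma all_mono x a b :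
  entails R [set a] b -> entails R [set All x a] (All x b).
Proof.
move=> dab; apply: (entails_allI (y := x)).
- rewrite subst_id; apply: entails_cut1 dab.
  rewrite -[X in entails _ _ X](subst_id x).
  by apply: entails_allE (free_for_id x a); apply: entails_assume.
- exact: free_for_id.
- by rewrite /= eqxx.
- by move=> _ ->; rewrite /= eqxx.
Qed.

Lemma ex_mono x a b :
  entails R [set a] b -> entails R [set Ex x a] (Ex x b).
Proof.
move=> dab; rewrite -[X in entails _ X _]setU0.
apply: (entails_exE (x := x) (y := x) (a := a)) => //=.
- exact: entails_assume.
- rewrite subst_id setU0; apply: entails_exI (free_for_id x b).
  by rewrite subst_id.
- exact: free_for_id.
- by rewrite eqxx.
- by rewrite eqxx.
Qed.

End Rules.

(** * The common form of the two translations *)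

Section Translate.
Set Implicit Arguments.
Unset Strict Implicit.
Context (sig : signature).

Fixpoint translate L L' (a : form sig L) : form sig L' :=
  match a with
  | Atom r v => Atom r v
  | And b c => And (translate L' b) (translate L' c)
  | Or b c => Or (translate L' b) (translate L' c)
  | Neg b => Neg (translate L' b)
  | Mod b => Neg (Mod (translate L' b))
  | Bot => Bot
  | All x b => All x (translate L' b)
  | Ex x b => Ex x (translate L' b)
  end.

Lemma t_translate : @t sig = translate LBox.
Proof.
by apply: funext; elim=> //= [b -> c ->|b -> c ->|b ->|b ->|x b ->|x b ->].
Qed.

Lemma s_translate : @s sig = translate LD.
Proof.
by apply: funext; elim=> //= [b -> c ->|b -> c ->|b ->|b ->|x b ->|x b ->].
Qed.

Section TwoLanguages.
Context (L L' : lang).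
Local Notation tr := (@translate L L').

Lemma free_translate x (a : form sig L) : free x (tr a) = free x a.
Proof. by elim: a => //= [b -> c ->|b -> c ->|z b ->|z b ->]. Qed.

Lemma free_for_translate y x (a : form sig L) :
  free_for y x (tr a) = free_for y x a.
Proof.
by elim: a => //= [b -> c ->|b -> c ->|z b ->|z b ->]; rewrite ?free_translate.
Qed.

Lemma subst_translate x y (a : form sig L) :
  tr (subst x y a) = subst x y (tr a).
Proof.
by elim: a => //= [b -> c ->|b -> c ->|b ->|b ->|z b IH|z b IH] //;
  rewrite -IH; case: ifP.
Qed.

Definition sound (R : rules sig L) (R' : rules sig L') :=
  forall P Q c G, R P Q c -> (forall p, P p -> entails R' G (tr p)) ->
    (forall q, Q q -> entails R' set0 (tr q)) -> entails R' G (tr c).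

(** A rule that discharges tr a leaves no assumption outside the image of what
    remains after the discharge of a. *)
Lemma image_discharge (B : set (form sig L)) a :
  tr @` B `<=` tr a |` tr @` (B `\ a).
Proof.
move=> _ [g Bg <-]; have [->|ga] := pselect (g = a); first by left.
by right; exists g.
Qed.

Lemma der_translate (R : rules sig L) (R' : rules sig L') A a :
  sound R R' -> der R A a -> entails R' (tr @` A) (tr a).
Proof.
move=> soundR; elim=> {A a} /=.
- by move=> a; apply: entails_assume; exists a.
- move=> A B a b _ IHa _ IHb; rewrite image_setU.
  apply: entails_andI.
    by apply: entails_sub IHa; apply: subsetUl.
  by apply: entails_sub IHb; apply: subsetUr.
- by move=> A a b _ /entails_andE1.
- by move=> A a b _ /entails_andE2.
- by move=> A a b _; apply: entails_orI1.
- by move=> A a b _; apply: entails_orI2.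
- move=> A B C a b c _ IHab _ IHa _ IHb; rewrite !image_setU.
  apply: (entails_orE (a := tr a) (b := tr b)).
  + by apply: entails_sub IHab => g ?; left; left.
  + apply: entails_sub IHa; apply: subset_trans (image_discharge a) _.
    by apply: setUS => g ?; left; right.
  + apply: entails_sub IHb; apply: subset_trans (image_discharge b) _.
    by apply: setUS => g ?; right.
- move=> A a _ IH; apply: entails_negI; apply: entails_sub IH.
  exact: image_discharge.
- move=> A B a _ IHa _ IHb; rewrite image_setU.
  apply: (entails_negE (a := tr a)).
    by apply: entails_sub IHa; apply: subsetUl.
  by apply: entails_sub IHb; apply: subsetUr.
- by move=> A a _; apply: entails_efq.
- move=> A x y a _ IH ff fr frA; apply: (entails_allI (y := y)).
  + by rewrite -subst_translate.
  + by rewrite free_for_translate.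
  + by rewrite /= free_translate.
  + by move=> _ [g /frA frg <-]; rewrite free_translate.
- move=> A x y a _ IH ff; rewrite subst_translate.
  by apply: entails_allE; rewrite ?free_for_translate.
- move=> A x y a _ IH ff; apply: (entails_exI (y := y)).
    by rewrite -subst_translate.
  by rewrite free_for_translate.
- move=> A B x y a c _ IHa _ IHc ff fr frc frB; rewrite image_setU.
  apply: (entails_exE IHa (y := y)).
  + by apply: entails_sub IHc; rewrite -subst_translate; apply: image_discharge.
  + by rewrite free_for_translate.
  + by rewrite /= free_translate.
  + by rewrite free_translate.
  + by move=> _ [g /frB frg <-]; rewrite free_translate.
- move=> P Q c A Rc _ IHP _ IHQ; apply: soundR Rc _ _ => [p Pp|q /IHQ].
    apply: entails_sub (IHP p Pp); apply: image_subset.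
    exact: bigcup_sup.
  by rewrite image_set0.
Qed.

Lemma entails_translate (R : rules sig L) (R' : rules sig L') G a :
  sound R R' -> entails R G a -> entails R' (tr @` G) (tr a).
Proof.
move=> soundR [A AG /(der_translate soundR)]; apply: entails_sub.
exact: image_subset.
Qed.

End TwoLanguages.

(** The hypothesis packs what replacement below the unary operator needs, as
    the double translation of Mod a is Neg (Neg (Mod _)). *)
Lemma double_translate L L' (R : rules sig L) :
  (forall a b, interderivable (entails R) a b ->
     interderivable (entails R) (Mod a) (Neg (Neg (Mod b)))) ->
  forall a : form sig L,
    interderivable (entails R) a (translate L (translate L' a)).
Proof.
move=> modR; elim=> /=
  [r v|a [a1 a2] b [b1 b2]|a [a1 a2] b [b1 b2]|a [a1 a2]|a IHa|
  |x a [a1 a2]|x a [a1 a2]].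
- exact: interderivable_refl.
- by split; apply: and_mono.
- by split; [apply: or_mono a1 b1 _|apply: or_mono a2 b2 _];
    apply: entails_assume.
- by split; [apply: neg_antitone a2 _|apply: neg_antitone a1 _];
    apply: entails_assume.
- exact: modR.
- exact: interderivable_refl.
- by split; apply: all_mono.
- by split; apply: ex_mono.
Qed.

Lemma translation_translate L L' (R : rules sig L) (R' : rules sig L') :
  finitary R -> sound R R' -> sound R' R ->
  (forall a : form sig L,
     interderivable (entails R) a (translate L (translate L' a))) ->
  translation (entails R) (entails R') (@translate L L').
Proof.
move=> finR RR' R'R dbl G a; split; first exact: entails_translate.
move=> /(entails_translate R'R) da; have [_ back] := dbl a.
apply: entails_cut1 back; apply: entails_cuts finR da _.
move=> _ [_ [g Gg <-] <-]; have [forth _] := dbl g.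
by apply: entails_sub forth => _ ->.
Qed.

(** * Derived rules of the two logics *)

Local Notation RD := (@rules_ID3 sig).
Local Notation RBox := (@rules_IBox3 sig).

Lemma finitary_ID3 : finitary RD.
Proof.
by move=> P Q c [] *;
  first [exact: finite_set0 | exact: finite_set1 | exact: finite_set2].
Qed.

Lemma finitary_IBox3 : finitary RBox.
Proof.
by move=> P Q c [] *;
  first [exact: finite_set0 | exact: finite_set1 | exact: finite_set2].
Qed.

Lemma entails_DE G a b : entails RD G (Dop a) -> entails RD set0 (Or a b) ->
  entails RD G b.
Proof. by move=> da dab; apply: (entails_rule (D_E a b)) => _ ->. Qed.

Lemma entails_DcS G a :
  entails RD G (Dop a) -> entails RD G (Dop (Dop a)) -> entails RD G Bot.
Proof. by move=> d1 d2; apply: (entails_rule (D_cS a)) => // _ [] ->. Qed.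

Lemma entails_NBoxE G a b : entails RBox G (Neg (Box a)) ->
  entails RBox set0 (Or a b) -> entails RBox G b.
Proof. by move=> da dab; apply: (entails_rule (NBox_E a b)) => _ ->. Qed.

Lemma entails_BoxS G a : entails RBox G (Neg a) -> entails RBox G (Box (Neg a)).
Proof. by move=> da; apply: (entails_rule (Box_S a)) => // _ ->. Qed.

Lemma entails_BoxcS G a :
  entails RBox G (Neg (Box (Neg (Box a)))) -> entails RBox G (Box a).
Proof. by move=> da; apply: (entails_rule (Box_cS a)) => // _ ->. Qed.

Lemma dneg_D G a : entails RD G (Neg (Neg (Dop a))) -> entails RD G (Dop a).
Proof.
move=> da; apply: (entails_orE (entails_axiom G (D_I (Dop a)))).
  by apply: entails_assume; left.
apply: entails_efq; apply: (entails_negE (a := Neg (Dop a))).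
  apply: entails_negI; apply: (entails_DcS (a := a)); apply: entails_assume.
    by left.
  by right; left.
by apply: entails_sub da; apply: subsetUr.
Qed.

Lemma dneg_Box G a :
  entails RBox G (Neg (Neg (Box a))) -> entails RBox G (Box a).
Proof.
move=> da; apply: (entails_orE (entails_axiom G (NBox_I (Neg (Box a))))).
  apply: entails_efq; apply: (entails_negE (a := Neg (Box a))).
    by apply: entails_assume; left.
  by apply: entails_sub da; apply: subsetUr.
by apply: entails_BoxcS; apply: entails_assume; left.
Qed.

Lemma D_antitone a b :
  entails RD [set b] a -> entails RD [set Dop a] (Dop b).
Proof.
move=> dba; apply: (entails_DE (a := a)); first exact: entails_assume.
by apply: or_mono dba _ (entails_axiom _ (D_I b)); apply: entails_assume.
Qed.

Lemma NBox_antitone a b :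
  entails RBox [set b] a -> entails RBox [set Neg (Box a)] (Neg (Box b)).
Proof.
move=> dba; apply: (entails_NBoxE (a := a)); first exact: entails_assume.
by apply: or_mono dba _ (entails_axiom _ (NBox_I b)); apply: entails_assume.
Qed.

Lemma dneg_D_congr a b : interderivable (entails RD) a b ->
  interderivable (entails RD) (Dop a) (Neg (Neg (Dop b))).
Proof.
move=> [dab dba]; split.
  exact: entails_cut1 (D_antitone dba) (dneg_intro RD _).
apply: entails_cut1 (D_antitone dab); apply: dneg_D.
exact: entails_assume.
Qed.

Lemma dneg_Box_congr a b : interderivable (entails RBox) a b ->
  interderivable (entails RBox) (Box a) (Neg (Neg (Box b))).
Proof.
move=> [dab dba]; split.
  apply: entails_negI; apply: (entails_negE (a := Box a)).
    by apply: entails_assume; right.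
  apply: entails_cut1 (NBox_antitone dab).
  by apply: entails_assume; left.
apply: dneg_Box; apply: neg_antitone (NBox_antitone dba) _.
exact: entails_assume.
Qed.

(** * Soundness of the two translations *)

Lemma sound_ID3_IBox3 : sound RD RBox.
Proof.
move=> P Q c G [a|a b|a|a|a b] /= dP dQ.
- exact: entails_axiom (NBox_I _).
- by apply: (entails_NBoxE (dP _ erefl)); apply: (dQ _ erefl).
- set a' := translate LBox a.
  apply: (or_mono (a := Neg a') (b := Neg (Box (Neg a')))).
  + exact: entails_assume.
  + apply: entails_negI; apply: (entails_negE (a := Box (Neg a'))).
      by apply: entails_BoxS; apply: entails_assume; left.
    by apply: entails_assume; right.
  + exact: entails_axiom (NBox_I _).
- apply: (entails_negE (a := Box (translate LBox a))).
    by apply: entails_BoxcS; apply: (dP (Dop (Dop a))); right.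
  by apply: (dP (Dop a)); left.
- set a' := translate LBox a; set b' := translate LBox b.
  apply: (entails_rule (Box_Reg a' b')) => // _ [] ->.
    by apply: dP; left.
  by apply: (dP (Dop a)); right.
Qed.

Lemma sound_IBox3_ID3 : sound RBox RD.
Proof.
move=> P Q c G [a|a b|a|a|a b] /= dP dQ.
- apply: (or_mono _ (dneg_intro RD _) (entails_axiom G (D_I _))).
  exact: entails_assume.
- by apply: (entails_DE (dneg_D (dP _ erefl))); apply: (dQ _ erefl).
- set a' := translate LD a.
  apply: entails_negI; apply: (entails_negE (a := Neg a')).
    by apply: entails_sub (dP _ erefl); apply: subsetUr.
  (* What remains of (S) for a' is Neg (Neg a'), against the premise Neg a'. *)
  apply: (entails_DE (a := Neg a')); first by apply: entails_assume; left.
  exact: entails_axiom (D_S _).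
- set a' := Dop (translate LD a).
  (* The premise is Neg (Neg (D (Neg (Neg a')))) and the goal is Neg a', the
     first disjunct of (S) for a': the disjuncts have to be swapped for D_E. *)
  apply: (entails_DE (a := Neg (Neg a'))).
    by apply: dneg_D; apply: (dP _ erefl).
  apply: (entails_orE (entails_axiom _ (D_S a'))).
    by apply: entails_orI2; apply: entails_assume; left.
  by apply: entails_orI1; apply: entails_assume; left.
- set a' := translate LD a; set b' := translate LD b.
  apply: (entails_rule (D_Reg a' b')) => // _ [] ->.
    by apply: dP; left.
  by apply: dneg_D; apply: (dP (Neg (Box a))); right.
Qed.

End Translate.

Theorem theorem1 (sig : signature) :
  [/\ (forall (G : set (form sig LD)) (a : form sig LD),
         entails_D G a <-> entails_Box (@t sig @` G) (t a)),
      (forall (G : set (form sig LBox)) (a : form sig LBox),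
         entails_Box G a <-> entails_D (@s sig @` G) (s a)) &
      equivalent_via (@entails_D sig) (@entails_Box sig) (@t sig) (@s sig)].
Proof.
rewrite t_translate s_translate.
have dblD := double_translate LBox (@dneg_D_congr sig).
have dblBox := double_translate LD (@dneg_Box_congr sig).
have trD := translation_translate (@finitary_ID3 sig) (@sound_ID3_IBox3 sig)
  (@sound_IBox3_ID3 sig) dblD.
have trBox := translation_translate (@finitary_IBox3 sig)
  (@sound_IBox3_ID3 sig) (@sound_ID3_IBox3 sig) dblBox.
by split.
Qed.
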